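(* Let $\Omega$ be a semigroup and let $(D,(\succ_{\alpha,\beta})_{\alpha,\beta\in\Omega},(\prec_{\alpha,\beta})_{\alpha,\beta\in\Omega})$ be an $\Omega$-dendriform $H$-pseudoalgebra. Define $$x*_{\alpha,\beta}y=x\succ_{\alpha,\beta}y+x\prec_{\alpha,\beta}y,\qquad x,y\in D,\ \alpha,\beta\in\Omega.$$ Then $(D,( *_{\alpha,\beta})_{\alpha,\beta\in\Omega})$ is an $\Omega$-associative $H$-pseudoalgebra.
   Context: $k$ is an algebraically closed field of characteristic zero and $H$ is a cocommutative Hopf algebra over $k$ with comultiplication $\Delta$; $\otimes=\otimes_k$. For $n\ge 1$, $H^{\otimes n}$ is a right $H$-module via the iterated comultiplication, and for a left $H$-module $M$ the space $H^{\otimes n}\otimes_H M$ is a left $H^{\otimes n}$-module by left multiplication. A linear map $*: L\otimes M\to H^{\otimes 2}\otimes_H N$ is $H^{\otimes 2}$-linear if $fa*gb=((f\otimes g)\otimes_H 1)(a*b)$ for all $f,g\in H$. Such maps are composed as follows: if $x*y=\sum_i (f_i\otimes g_i)\otimes_H e_i$ and $F\in H^{\otimes 2}$, then $$(F\otimes_H x)*y=\sum_i (F\otimes 1)(\Delta\otimes \mathrm{id})(f_i\otimes g_i)\otimes_H e_i,\qquad x*(F\otimes_H y)=\sum_i (1\otimes F)(\mathrm{id}\otimes\Delta)(f_i\otimes g_i)\otimes_H e_i,$$ elements of $H^{\otimes 3}\otimes_H N$. An $\Omega$-dendriform $H$-pseudoalgebra is a left $H$-module $D$ with $H^{\otimes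 2}$-linear maps $\prec_{\alpha,\beta},\succ_{\alpha,\beta}:D\otimes D\to H^{\otimes 2}\otimes_H D$ for each $(\alpha,\beta)\in\Omega^2$ such that for all $x,y,z\in D$, $\alpha,\beta,\gamma\in\Omega$: $(x\prec_{\alpha,\beta}y)\prec_{\alpha\beta,\gamma}z=x\prec_{\alpha,\beta\gamma}(y\prec_{\beta,\gamma}z+y\succ_{\beta,\gamma}z)$; $(x\succ_{\alpha,\beta}y)\prec_{\alpha\beta,\gamma}z=x\succ_{\alpha,\beta\gamma}(y\prec_{\beta,\gamma}z)$; $(x\prec_{\alpha,\beta}y+x\succ_{\alpha,\beta}y)\succ_{\alpha\beta,\gamma}z=x\succ_{\alpha,\beta\gamma}(y\succ_{\beta,\gamma}z)$. An $\Omega$-associative $H$-pseudoalgebra is a left $H$-module $A$ with $H^{\otimes 2}$-linear maps $*_{\alpha,\beta}:A\otimes A\to H^{\otimes 2}\otimes_H A$ ($\alpha,\beta\in\Omega$) such that $(a*_{\alpha,\beta}b)*_{\alpha\beta,\gamma}c=a*_{\alpha,\beta\gamma}(b*_{\beta,\gamma}c)$ for all $a,b,c\in A$, $\alpha,\beta,\gamma\in\Omega$. *)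

(* Defs.v *)
From HB Require Import structures.
From mathcomp Require Import all_boot all_order all_algebra.
From mathcomp Require Import boolp classical_sets.
From mathcomp Require Import freeg.

Set Implicit Arguments.
Unset Strict Implicit.
Unset Printing Implicit Defensive.

Import GRing.Theory.
Local Open Scope ring_scope.
Local Open Scope quotient_scope.

Reserved Notation "u \ox v" (at level 40, left associativity).

Section BalancedTensor.
Variables (U V : zmodType) (S : Type) (r : U -> S -> U) (l : S -> V -> V).

Local Notation F := {freeg (U * V)%type / int}.
Local Notation gen u v := (Freeg [:: (1%:Z, (u, v))] : F).

Inductive balanced_span : F -> Prop :=
| Span0 : balanced_span 0
| SpanB x y : balanced_span x -> balanced_span y -> balanced_span (x - y)
| SpanDl u u' v : balanced_span (gen (u + u') v - gen u v - gen u' v)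
| SpanDr u v v' : balanced_span (gen u (v + v') - gen u v - gen u v')
| SpanM u s v : balanced_span (gen (r u s) v - gen u (l s v)).

(* The generated subgroup is not decidable in general; `[< _ >] is its
   classical characteristic predicate, as needed to form the quotient. *)
Definition balanced_pred : pred F := fun x => `[< balanced_span x >].

Lemma balanced_pred_zmod : zmod_closed balanced_pred.
Proof.
split; first by apply/asboolP; exact: Span0.
by move=> x y /asboolP hx /asboolP hy; apply/asboolP; exact: SpanB.
Qed.

HB.instance Definition _ :=
  GRing.isZmodClosed.Build F balanced_pred balanced_pred_zmod.

Local Notation bquot := (Quotient.quot (GRing.ZmodClosed.clone F balanced_pred _)).

Definition balanced_tensor : Type := bquot.
HB.instance Definition _ := GRing.Zmodule.on balanced_tensor.

Definition btens (u : U) (v : V) : balanced_tensor :=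
  \pi_bquot (gen u v).

Lemma bpi_eq (x y : F) : balanced_span (x - y) ->
  \pi_bquot x = \pi_bquot y.
Proof.
by move=> h; apply/eqP; rewrite -Quotient.idealrBE; apply/asboolP.
Qed.

Lemma btensDl u u' v : btens (u + u') v = btens u v + btens u' v.
Proof.
rewrite /btens -[RHS]raddfD; apply: bpi_eq.
by rewrite opprD addrA; exact: SpanDl.
Qed.

Lemma btensDr u v v' : btens u (v + v') = btens u v + btens u v'.
Proof.
rewrite /btens -[RHS]raddfD; apply: bpi_eq.
by rewrite opprD addrA; exact: SpanDr.
Qed.

Lemma btensM u s v : btens (r u s) v = btens u (l s v).
Proof. exact/bpi_eq/SpanM. Qed.

Definition balanced (W : zmodType) (f : U -> V -> W) : Prop :=
  [/\ forall u u' v, f (u + u') v = f u v + f u' v,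
      forall u v v', f u (v + v') = f u v + f u v'
    & forall u s v, f (r u s) v = f u (l s v)].

(* Total in f, but only meaningful when f is balanced: see blift_tens. *)
Definition blift (W : zmodType) (f : U -> V -> W) (t : balanced_tensor) : W :=
  fglift (fun p => f p.1 p.2 : zmodule W) (repr (t : bquot)).

Section Lift.
Variables (W : zmodType) (f : U -> V -> W).
Hypothesis bf : balanced f.

Let L (x : F) : W := fglift (fun p => f p.1 p.2 : zmodule W) x.

Let L_add : zmod_morphism L.
Proof. exact: (@lift_is_additive _ _ (zmodule W)). Qed.

Let L_gen u v : L (gen u v) = f u v.
Proof. by rewrite /L liftU [LHS]scale1r. Qed.

Let L_span x : balanced_span x -> L x = 0.
Proof.
have [Dl Dr M] := bf.
elim=> [|x' y' _ hx _ hy|u u' v|u v v'|u s v].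
- by rewrite -[X in L X](subrr 0) L_add subrr.
- by rewrite L_add hx hy subrr.
- by rewrite !L_add !L_gen Dl addrAC addrK subrr.
- by rewrite !L_add !L_gen Dr addrAC addrK subrr.
- by rewrite L_add !L_gen M subrr.
Qed.

Let blift_pi (x : F) : blift f (\pi_bquot x) = L x.
Proof.
apply/eqP; rewrite -subr_eq0 -[blift _ _]/(L _) -L_add; apply/eqP/L_span.
by apply/asboolP; rewrite -[asbool _]/(_ \in balanced_pred) Quotient.idealrBE reprK.
Qed.

Lemma blift_tens u v : blift f (btens u v) = f u v.
Proof. by rewrite blift_pi L_gen. Qed.

Lemma blift_is_zmod_morphism : zmod_morphism (blift f).
Proof.
move=> x y.
have pi_ex t : exists X, t = \pi_bquot X by exists (repr t); rewrite reprK.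
have [X ->] := pi_ex x; have [Y ->] := pi_ex y.
have -> : (\pi_bquot X - \pi_bquot Y : balanced_tensor) = \pi_bquot (X - Y).
  by rewrite raddfB.
by rewrite !blift_pi L_add.
Qed.

End Lift.

Lemma balanced_ind (P : balanced_tensor -> Prop) :
  P 0 -> (forall x y, P x -> P y -> P (x - y)) ->
  (forall u v, P (btens u v)) -> forall t, P t.
Proof.
move=> P0 PB Pt t; rewrite -[t]reprK.
have PN x : P x -> P (- x) by move=> hx; rewrite -[- x]sub0r; exact: PB.
have PD x y : P x -> P y -> P (x + y).
  by move=> hx /PN hy; rewrite -[y]opprK; apply: PB.
have Pn x n : P x -> P (x *+ n).
  by move=> hx; elim: n => // n IH; rewrite mulrS; exact: PD.
rewrite -[repr _]freeg_sumE raddf_sum; apply: (big_ind P) => // -[u v] _.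
have -> (c : int) : Freeg [:: (c, (u, v))] = gen u v *~ c :> F.
  by rewrite freegU_mulz intz.
rewrite raddfMz /=; case: (coeff _ _) => n; first exact/Pn/Pt.
by rewrite NegzE mulrNz; apply/PN/Pn/Pt.
Qed.

End BalancedTensor.

(* Canonical structures on nested tensor products are too slow to unify if
   these are unfolded. *)
Global Opaque balanced_tensor btens blift.

Section Tensor.
Variables (k : fieldType) (U V : lmodType k).

Definition tensor : Type :=
  balanced_tensor (fun (u : U) (c : k) => c *: u) (fun c (v : V) => c *: v).
HB.instance Definition _ := GRing.Zmodule.on tensor.

Definition tens (u : U) (v : V) : tensor := btens _ _ u v.
Local Notation "u \ox v" := (tens u v).

Definition tlift (W : zmodType) (f : U -> V -> W) : tensor -> W := blift f.

Local Notation bilinear_map f := (bilinear_for *:%R *:%R f).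

Lemma tensDl u u' v : (u + u') \ox v = u \ox v + u' \ox v.
Proof. exact: btensDl. Qed.

Lemma tensDr u v v' : u \ox (v + v') = u \ox v + u \ox v'.
Proof. exact: btensDr. Qed.

Lemma tensZlr c u v : (c *: u) \ox v = u \ox (c *: v).
Proof. exact: btensM. Qed.

Lemma tensor_ind (P : tensor -> Prop) :
  P 0 -> (forall x y, P x -> P y -> P (x - y)) ->
  (forall u v, P (u \ox v)) -> forall t, P t.
Proof. exact: balanced_ind. Qed.

Definition tscale (c : k) : tensor -> tensor :=
  tlift (fun u v => (c *: u) \ox v).

Let tscale_balanced c : balanced (fun (u : U) (a : k) => a *: u)
  (fun a (v : V) => a *: v) (fun u v => (c *: u) \ox v).
Proof.
split=> [u u' v|u v v'|u a v]; first by rewrite scalerDr tensDl.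
  exact: tensDr.
by rewrite scalerA mulrC -scalerA tensZlr.
Qed.

Let tscale_tens c u v : tscale c (u \ox v) = (c *: u) \ox v.
Proof. exact: (blift_tens (tscale_balanced c)). Qed.

Let tscaleB c : {morph tscale c : x y / x - y}.
Proof. exact: (blift_is_zmod_morphism (tscale_balanced c)). Qed.

Let tscale0 c : tscale c 0 = 0.
Proof. by rewrite -[X in tscale c X](subrr 0) tscaleB subrr. Qed.

Let tscaleA a b v : tscale a (tscale b v) = tscale (a * b) v.
Proof.
elim/tensor_ind: v => [|x y hx hy|u v]; first by rewrite !tscale0.
  by rewrite !tscaleB hx hy.
by rewrite !tscale_tens scalerA.
Qed.

Let tscale1 : left_id 1 tscale.
Proof.
elim/tensor_ind=> [|x y hx hy|u v]; first by rewrite !tscale0.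
  by rewrite !tscaleB hx hy.
by rewrite !tscale_tens scale1r.
Qed.

Let tscaleDr : right_distributive tscale +%R.
Proof.
move=> c x y; have tsN z : tscale c (- z) = - tscale c z.
  by rewrite -[- z]sub0r tscaleB tscale0 sub0r.
by rewrite -[y in LHS]opprK tscaleB tsN opprK.
Qed.

Let tscaleDl v : {morph tscale^~ v : a b / a + b}.
Proof.
move=> a b; elim/tensor_ind: v => [|x y hx hy|u v] /=.
- by rewrite !tscale0 addr0.
- by rewrite !tscaleB hx hy opprD addrACA.
- by rewrite !tscale_tens scalerDl tensDl.
Qed.

HB.instance Definition _ := GRing.Zmodule_isLmodule.Build k tensor
  tscaleA tscale1 tscaleDr tscaleDl.

Lemma tensZl c u v : (c *: u) \ox v = c *: (u \ox v).
Proof. by rewrite -[RHS]/(tscale c (u \ox v)) tscale_tens. Qed.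

Lemma tensZr c u v : u \ox (c *: v) = c *: (u \ox v).
Proof. by rewrite -tensZlr tensZl. Qed.

Lemma tens_bilinear : bilinear_map tens.
Proof.
split=> [v c u u'|u c v v'] /=; first by rewrite tensDl tensZl.
by rewrite tensDr tensZr.
Qed.

Lemma bilinear_balanced (W : lmodType k) (f : U -> V -> W) :
  bilinear_map f ->
  balanced (fun (u : U) (a : k) => a *: u) (fun a (v : V) => a *: v) f.
Proof.
move=> [fl fr]; split=> [u u' v|u v v'|u c v].
- by have := fl v 1 u u'; rewrite /= !scale1r.
- by have := fr u 1 v v'; rewrite /= !scale1r.
- by rewrite (scalable_linear (fl v)) (scalable_linear (fr u)).
Qed.

Section Lift.
Variables (W : lmodType k) (f : U -> V -> W).
Hypothesis bf : bilinear_map f.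

Lemma tlift_tens u v : tlift f (u \ox v) = f u v.
Proof. exact: (blift_tens (bilinear_balanced bf)). Qed.

Lemma tlift_is_linear : linear (tlift f).
Proof.
have fB : {morph tlift f : x y / x - y}.
  exact: (blift_is_zmod_morphism (bilinear_balanced bf)).
have f0 : tlift f 0 = 0 by rewrite -[X in tlift f X](subrr 0) fB subrr.
have fZ c t : tlift f (c *: t) = c *: tlift f t.
  elim/tensor_ind: t => [|x y hx hy|u v]; first by rewrite scaler0 f0 scaler0.
    by rewrite scalerBr !fB hx hy -scalerBr.
  by rewrite -tensZl !tlift_tens (scalable_linear (bf.1 v)).
have fN t : tlift f (- t) = - tlift f t.
  by rewrite -[- t]sub0r fB f0 sub0r.
by move=> c x y; rewrite -[y in LHS]opprK fB fN opprK fZ.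
Qed.

End Lift.

Lemma tensor_eq (W : lmodType k) (f g : {linear tensor -> W}) :
  (forall u v, f (u \ox v) = g (u \ox v)) -> f =1 g.
Proof.
move=> fg; elim/tensor_ind=> [|x y hx hy|//]; first by rewrite !linear0.
by rewrite !linearB hx hy.
Qed.

End Tensor.

Global Opaque tlift tscale.

Notation "u \ox v" := (tens u v).

Lemma linear_form_exists (k : fieldType) (V : lmodType k) (e : V) :
  e != 0 -> exists2 phi : V -> k, scalar phi & phi e = 1.
Proof.
move=> e0.
pose P (X : set V) := (forall a x y, X x -> X y -> X (a *: x + y)) /\ ~ X e.
have [F FP Ftot|W [[Wlin We] Wmax]] := @Zorn_bigcup V P.
  split=> [a x y [X FX Xx] [Y FY Yy]|[X FX Xe]]; last exact: (FP _ FX).2.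
  have [XY|YX] := Ftot _ _ FX FY.
    by exists Y => //; apply: (FP _ FY).1 => //; exact: XY.
  by exists X => //; apply: (FP _ FX).1 => //; exact: YX.
have W0 : W 0.
  apply: contrapT => nW0; apply: (Wmax [set 0]%classic); last first.
    split=> [a x y -> ->|/=]; first by rewrite /= scaler0 addr0.
    by move=> ee; rewrite ee eqxx in e0.
  split=> [x Wx|sub0]; last exact/nW0/sub0.
  by case: nW0; rewrite -(addNr x) -scaleN1r; exact: Wlin.
have WZ a x : W x -> W (a *: x) by move=> Wx; rewrite -[_ *: _]addr0; exact: Wlin.
have WD x y : W x -> W y -> W (x + y).
  by move=> Wx Wy; rewrite -[x]scale1r; exact: Wlin.
have ex v : exists c, W (v - c *: e).
  have [Wv|nWv] := pselect (W v); first by exists 0; rewrite scale0r subr0.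
  pose X : set V := [set y | exists c, W (y - c *: v)]%classic.
  have WX : (W `<` X)%classic.
    split=> [x Wx|XW]; first by exists 0; rewrite scale0r subr0.
    by apply/nWv/XW; exists 1; rewrite scale1r subrr.
  have [c We'] : X e.
    apply: contrapT => nXe; apply: (Wmax X WX); split=> // a x y [c Wx] [d Wy].
    exists (a * c + d); rewrite scalerDl opprD addrACA -scalerA -scalerBr.
    exact: Wlin.
  have c0 : c != 0.
    by apply/eqP => c0; apply: We; rewrite c0 scale0r subr0 in We'.
  exists c^-1; have := WZ (- c^-1) _ We'.
  by rewrite scalerBr scalerA mulNr mulVf // scaleN1r opprK scaleNr addrC.
pose phi v := projT1 (cid (ex v)).
have phiP v : W (v - phi v *: e) by exact: projT2 (cid (ex v)).
have uniq v c : W (v - c *: e) -> phi v = c.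
  move=> Wc; apply: contrapT => /eqP; rewrite -subr_eq0 => d0.
  apply: We; have := WD _ _ Wc (WZ (-1) _ (phiP v)).
  rewrite scaleN1r opprB addrC addrA subrK -scalerBl.
  by move=> /(WZ (phi v - c)^-1); rewrite scalerA mulVf // scale1r.
exists phi; last by apply: uniq; rewrite scale1r subrr.
move=> a x y; apply: uniq.
rewrite scalerDl opprD addrACA -scalerA -scalerBr; exact: Wlin.
Qed.

Section TensorMaps.
Variable k : fieldType.
Local Notation bilinear_map f := (bilinear_for *:%R *:%R f).

Section Map.
Variables (U U' V V' : lmodType k) (f : {linear U -> U'}) (g : {linear V -> V'}).

Definition tensor_map : tensor U V -> tensor U' V' :=
  tlift (fun u v => f u \ox g v).

Let tensor_map_bilinear : bilinear_map (fun u v => f u \ox g v).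
Proof.
split=> [v c u u'|u c v v'] /=.
  by rewrite linearP tensDl tensZl.
by rewrite linearP tensDr tensZr.
Qed.

Lemma tensor_map_tens u v : tensor_map (u \ox v) = f u \ox g v.
Proof. exact: tlift_tens tensor_map_bilinear u v. Qed.

HB.instance Definition _ := GRing.isLinear.Build k (tensor U V) (tensor U' V') _
  tensor_map (tlift_is_linear tensor_map_bilinear).
End Map.

Section Swap.
Variables (U V : lmodType k).

Definition tensor_swap : tensor U V -> tensor V U := tlift (fun u v => v \ox u).

Let swap_bilinear : bilinear_map (fun (u : U) (v : V) => v \ox u).
Proof.
split=> [v c u u'|u c v v'] /=; first by rewrite tensDr tensZr.
by rewrite tensDl tensZl.
Qed.

Lemma tensor_swap_tens u v : tensor_swap (u \ox v) = v \ox u.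
Proof. exact: tlift_tens swap_bilinear u v. Qed.

HB.instance Definition _ := GRing.isLinear.Build k (tensor U V) (tensor V U) _
  tensor_swap (tlift_is_linear swap_bilinear).
End Swap.

Section Assoc.
Variables (U V W : lmodType k).

Definition tensor_assoc : tensor U (tensor V W) -> tensor (tensor U V) W :=
  tlift (fun u => tlift (fun v w => u \ox v \ox w)).

Let inner_bilinear u : bilinear_map (fun (v : V) (w : W) => (u : U) \ox v \ox w).
Proof.
split=> [w c v v'|v c w w'] /=; last by rewrite tensDr tensZr.
by rewrite tensDr tensZr tensDl tensZl.
Qed.

Let inner_tens u v w :
  tlift (fun (v : V) (w : W) => (u : U) \ox v \ox w) (v \ox w) = u \ox v \ox w.
Proof. exact: tlift_tens (inner_bilinear u) v w. Qed.

Let inner_linear u := tlift_is_linear (inner_bilinear u).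

Let assoc_bilinear :
  bilinear_map (fun (u : U) => tlift (fun (v : V) (w : W) => u \ox v \ox w)).
Proof.
split=> [t c u u'|u] /=; last exact: inner_linear.
pose L u := tlift (fun (v : V) (w : W) => (u : U) \ox v \ox w).
have LB x : {morph L x : s t / s - t} by exact: (zmod_morphism_linear (inner_linear x)).
have L0 x : L x 0 = 0 by rewrite -[X in L x X](subrr 0) LB subrr.
rewrite -![tlift _ t]/(L _ t); elim/tensor_ind: t => [|s t hs ht|v w].
- by rewrite !L0 scaler0 addr0.
- by rewrite !LB hs ht opprD addrACA -scalerBr.
- by rewrite /L !inner_tens !tensDl !tensZl.
Qed.

Lemma tensor_assoc_tens u v w :
  tensor_assoc (u \ox (v \ox w)) = u \ox v \ox w.
Proof. by rewrite [LHS](tlift_tens assoc_bilinear) inner_tens. Qed.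

HB.instance Definition _ := GRing.isLinear.Build k
  (tensor U (tensor V W)) (tensor (tensor U V) W) _
  tensor_assoc (tlift_is_linear assoc_bilinear).
End Assoc.
End TensorMaps.

Section TensorAlgebra.
Variables (k : fieldType) (A B : algType k).
Local Notation bilinear_map f := (bilinear_for *:%R *:%R f).

Let tmul_pure (a : A) (b : B) : tensor A B -> tensor A B :=
  tlift (fun a' b' => (a * a') \ox (b * b')).

Let pure_bilinear (a : A) (b : B) :
  bilinear_map (fun (a' : A) (b' : B) => (a * a') \ox (b * b')).
Proof.
split=> [b' c a1 a2|a' c b1 b2] /=.
  by rewrite mulrDr -scalerAr tensDl tensZl.
by rewrite mulrDr -scalerAr tensDr tensZr.
Qed.

Let pure_tens a b a' b' : tmul_pure a b (a' \ox b') = (a * a') \ox (b * b').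
Proof. exact: tlift_tens (pure_bilinear a b) a' b'. Qed.

Let pure_linear a b : linear (tmul_pure a b).
Proof. exact: tlift_is_linear (pure_bilinear a b). Qed.

Definition tmul (s t : tensor A B) : tensor A B :=
  tlift (fun a b => tlift (fun a' b' => (a * a') \ox (b * b')) t) s.

Let pureB a b : {morph tmul_pure a b : x y / x - y}.
Proof. exact: (zmod_morphism_linear (pure_linear a b)). Qed.

Let pure0 a b : tmul_pure a b 0 = 0.
Proof. by rewrite -[X in tmul_pure a b X](subrr 0) pureB subrr. Qed.

Let tmul_bilinear t : bilinear_map (fun a b => tmul_pure a b t).
Proof.
split=> [b c a1 a2|a c b1 b2] /=.
  elim/tensor_ind: t => [|s t hs ht|a b'].
  - by rewrite !pure0 scaler0 addr0.
  - by rewrite !pureB hs ht scalerBr opprD addrACA.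
  - by rewrite !pure_tens mulrDl -scalerAl tensDl tensZl.
elim/tensor_ind: t => [|s t hs ht|a' b'].
- by rewrite !pure0 scaler0 addr0.
- by rewrite !pureB hs ht scalerBr opprD addrACA.
- by rewrite !pure_tens mulrDl -scalerAl tensDr tensZr.
Qed.

Let tmul_tensl a b t : tmul (a \ox b) t = tmul_pure a b t.
Proof. exact: tlift_tens (tmul_bilinear t) a b. Qed.

Let tmul_tens a b a' b' :
  tmul (a \ox b) (a' \ox b') = (a * a') \ox (b * b').
Proof. by rewrite tmul_tensl pure_tens. Qed.

Let tmul_linl t : linear (tmul^~ t).
Proof. exact: tlift_is_linear (tmul_bilinear t). Qed.

Let tmulBl t : {morph tmul^~ t : x y / x - y}.
Proof. exact: (zmod_morphism_linear (tmul_linl t)). Qed.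

Let tmul0t t : tmul 0 t = 0.
Proof. by rewrite -[X in tmul X t](subrr 0) tmulBl subrr. Qed.

Let tmul_linr s : linear (tmul s).
Proof.
move=> c x y; elim/tensor_ind: s => [|s s' hs hs'|a b].
- by rewrite !tmul0t scaler0 addr0.
- by rewrite !tmulBl hs hs' scalerBr opprD addrACA.
- by rewrite !tmul_tensl; exact: pure_linear.
Qed.

Let tmulBr s : {morph tmul s : x y / x - y}.
Proof. exact: (zmod_morphism_linear (tmul_linr s)). Qed.

Let tmult0 s : tmul s 0 = 0.
Proof. by rewrite -[X in tmul s X](subrr 0) tmulBr subrr. Qed.

Let tmulA : associative tmul.
Proof.
move=> s t u.
elim/tensor_ind: s => [|x y hx hy|a1 b1]; first by rewrite !tmul0t.
  by rewrite !tmulBl hx hy.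
elim/tensor_ind: t => [|x y hx hy|a2 b2]; first by rewrite tmult0 !tmul0t tmult0.
  by rewrite tmulBr !tmulBl tmulBr hx hy.
elim/tensor_ind: u => [|x y hx hy|a3 b3]; first by rewrite !tmult0.
  by rewrite !tmulBr hx hy.
by rewrite !tmul_tens !mulrA.
Qed.

Let tmul1t : left_id (1 \ox 1) tmul.
Proof.
elim/tensor_ind=> [|x y hx hy|a b]; first by rewrite tmult0.
  by rewrite tmulBr hx hy.
by rewrite tmul_tens !mul1r.
Qed.

Let tmult1 : right_id (1 \ox 1) tmul.
Proof.
elim/tensor_ind=> [|x y hx hy|a b]; first by rewrite tmul0t.
  by rewrite tmulBl hx hy.
by rewrite tmul_tens !mulr1.
Qed.

Let tmulDl : left_distributive tmul +%R.
Proof. by move=> x y t; have := tmul_linl t 1 x y; rewrite !scale1r. Qed.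

Let tmulDr : right_distributive tmul +%R.
Proof. by move=> s x y; have := tmul_linr s 1 x y; rewrite !scale1r. Qed.

Let tone_neq0 : (1 : A) \ox (1 : B) != 0 :> tensor A B.
Proof.
have [phi phi_lin phi1] := linear_form_exists (oner_neq0 A).
have [psi psi_lin psi1] := linear_form_exists (oner_neq0 B).
have bil : bilinear_map (fun (a : A) (b : B) => phi a * psi b : k^o).
  split=> [b c a1 a2|a c b1 b2] /=.
    by rewrite phi_lin mulrDl -mulrA.
  by rewrite psi_lin mulrDr mulrCA.
apply/eqP => e; have := tlift_tens bil 1 1; rewrite e phi1 psi1 mulr1.
have := zmod_morphism_linear (tlift_is_linear bil) 0 0; rewrite !subrr => ->.
by move=> /esym/eqP; rewrite oner_eq0.
Qed.

HB.instance Definition _ := GRing.Zmodule_isNzRing.Build (tensor A B)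
  tmulA tmul1t tmult1 tmulDl tmulDr tone_neq0.

Lemma tensM (a a' : A) (b b' : B) :
  (a \ox b) * (a' \ox b') = (a * a') \ox (b * b').
Proof. exact: tmul_tens. Qed.

Lemma tens1 : (1 : A) \ox (1 : B) = 1.
Proof. by []. Qed.

HB.instance Definition _ := GRing.Lmodule_isLalgebra.Build k (tensor A B)
  (fun c x y => esym (scalable_linear (tmul_linl y) c x)).
HB.instance Definition _ := GRing.Lalgebra_isAlgebra.Build k (tensor A B)
  (fun c x y => esym (scalable_linear (tmul_linr x) c y)).

End TensorAlgebra.

Global Opaque tmul.

Section TensorMapMorphism.
Variables (k : fieldType) (A A' B B' : algType k).
Variables (f : {lrmorphism A -> A'}) (g : {lrmorphism B -> B'}).

Let mapB : {morph tensor_map f g : x y / x - y}.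
Proof. exact: linearB. Qed.

Let map0 : tensor_map f g 0 = 0.
Proof. exact: linear0. Qed.

Let tensor_map_monoid : monoid_morphism (tensor_map f g).
Proof.
split=> [|s t]; first by rewrite -!tens1 tensor_map_tens !rmorph1.
elim/tensor_ind: s => [|x y hx hy|a b]; first by rewrite !(mul0r, map0).
  by rewrite mulrBl !mapB mulrBl hx hy.
elim/tensor_ind: t => [|x y hx hy|a' b']; first by rewrite !(mulr0, map0).
  by rewrite mulrBr !mapB mulrBr hx hy.
by rewrite tensM !tensor_map_tens tensM !rmorphM.
Qed.

HB.instance Definition _ := GRing.isMonoidMorphism.Build
  (tensor A B) (tensor A' B') (tensor_map f g) tensor_map_monoid.
End TensorMapMorphism.

Section ExtendScalars.
Variables (R A : pzRingType) (d : {rmorphism R -> A}) (M : lmodType R).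

(* A \otimes_R M, where A is a right R-module through d: for A the n-th tensor
   power of H and d the iterated comultiplication this is the left module
   H^{\otimes n} \otimes_H M. *)
Definition extend_scalars : Type :=
  balanced_tensor (fun (a : A) (h : R) => a * d h) (fun h (m : M) => h *: m).
HB.instance Definition _ := GRing.Zmodule.on extend_scalars.

Definition stens (a : A) (m : M) : extend_scalars := btens _ _ a m.
Local Notation "a \oxs m" := (stens a m) (at level 40).

Definition slift (W : zmodType) (f : A -> M -> W) : extend_scalars -> W :=
  blift f.

Definition sbalanced (W : zmodType) (f : A -> M -> W) : Prop :=
  balanced (fun (a : A) (h : R) => a * d h) (fun h (m : M) => h *: m) f.

Lemma stensDl a a' m : (a + a') \oxs m = a \oxs m + a' \oxs m.
Proof. exact: btensDl. Qed.

Lemma stensDr a m m' : a \oxs (m + m') = a \oxs m + a \oxs m'.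
Proof. exact: btensDr. Qed.

Lemma stensM a h m : (a * d h) \oxs m = a \oxs (h *: m).
Proof. exact: btensM. Qed.

Lemma stens_ind (P : extend_scalars -> Prop) :
  P 0 -> (forall x y, P x -> P y -> P (x - y)) ->
  (forall a m, P (a \oxs m)) -> forall t, P t.
Proof. exact: balanced_ind. Qed.

Section Lift.
Variables (W : zmodType) (f : A -> M -> W).
Hypothesis bf : sbalanced f.

Lemma slift_stens a m : slift f (a \oxs m) = f a m.
Proof. exact: blift_tens bf a m. Qed.

Lemma slift_is_zmod_morphism : zmod_morphism (slift f).
Proof. exact: blift_is_zmod_morphism bf. Qed.

Lemma slift0 : slift f 0 = 0.
Proof. by have := slift_is_zmod_morphism 0 0; rewrite !subrr. Qed.

Lemma sliftD : {morph slift f : x y / x + y}.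
Proof.
have sB := slift_is_zmod_morphism.
by move=> x y; rewrite -[y in LHS]opprK sB -[- y]sub0r sB slift0 sub0r opprK.
Qed.
End Lift.

Definition sscale (b : A) : extend_scalars -> extend_scalars :=
  slift (fun a m => (b * a) \oxs m).

Let sscale_balanced b : sbalanced (fun a m => (b * a) \oxs m).
Proof.
split=> [a a' m|a m m'|a h m]; first by rewrite mulrDr stensDl.
  exact: stensDr.
by rewrite mulrA stensM.
Qed.

Let sscale_stens b a m : sscale b (a \oxs m) = (b * a) \oxs m.
Proof. exact: slift_stens (sscale_balanced b) a m. Qed.

Let sscaleB b : {morph sscale b : x y / x - y}.
Proof. exact: slift_is_zmod_morphism (sscale_balanced b). Qed.

Let sscale0 b : sscale b 0 = 0.
Proof. exact: slift0 (sscale_balanced b). Qed.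

Let sscaleA b c t : sscale b (sscale c t) = sscale (b * c) t.
Proof.
elim/stens_ind: t => [|x y hx hy|a m]; first by rewrite !sscale0.
  by rewrite !sscaleB hx hy.
by rewrite !sscale_stens mulrA.
Qed.

Let sscale1 : left_id 1 sscale.
Proof.
elim/stens_ind=> [|x y hx hy|a m]; first by rewrite !sscale0.
  by rewrite !sscaleB hx hy.
by rewrite !sscale_stens mul1r.
Qed.

Let sscaleDr : right_distributive sscale +%R.
Proof. by move=> b x y; exact: sliftD (sscale_balanced b) x y. Qed.

Let sscaleDl t : {morph sscale^~ t : b c / b + c}.
Proof.
move=> b c; elim/stens_ind: t => [|x y hx hy|a m] /=.
- by rewrite !sscale0 addr0.
- by rewrite !sscaleB hx hy opprD addrACA.
- by rewrite !sscale_stens mulrDl stensDl.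
Qed.

HB.instance Definition _ := GRing.Zmodule_isLmodule.Build A extend_scalars
  sscaleA sscale1 sscaleDr sscaleDl.

Lemma scale_stens b a m : b *: (a \oxs m) = (b * a) \oxs m.
Proof. by rewrite -[LHS]/(sscale b (a \oxs m)) sscale_stens. Qed.
End ExtendScalars.

Global Opaque slift sscale.

Section SliftComp.
Variables (R A B : pzRingType).
Variables (d2 : {rmorphism R -> A}) (d3 : {rmorphism R -> B}).
Variables (phi : {rmorphism A -> B}) (M N : lmodType R).
Hypothesis phi_d : forall h, phi (d2 h) = d3 h.

Local Notation inner K := (fun G (e : N) => stens d3 (K * phi G) e).

Lemma inner_balanced (K : B) : sbalanced d2 (inner K).
Proof.
split=> [G G' e|G e e'|G h e].
- by rewrite rmorphD mulrDr stensDl.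
- by rewrite stensDr.
- by rewrite rmorphM mulrA phi_d stensM.
Qed.

Lemma slift_innerDl K K' (T : extend_scalars d2 N) :
  slift (inner (K + K')) T = slift (inner K) T + slift (inner K') T.
Proof.
have sB L := slift_is_zmod_morphism (inner_balanced L).
elim/stens_ind: T => [|S T hS hT|G e].
- by rewrite !(slift0 (inner_balanced _)) addr0.
- by rewrite !sB hS hT opprD addrACA.
- by rewrite !(slift_stens (inner_balanced _)) mulrDl stensDl.
Qed.

Lemma slift_innerZ K b (T : extend_scalars d2 N) :
  slift (inner K) (b *: T) = slift (inner (K * phi b)) T.
Proof.
have sB L := slift_is_zmod_morphism (inner_balanced L).
elim/stens_ind: T => [|S T hS hT|G e].
- by rewrite scaler0 !(slift0 (inner_balanced _)).
- by rewrite scalerBr !sB hS hT.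
- by rewrite scale_stens !(slift_stens (inner_balanced _)) rmorphM mulrA.
Qed.

Variables (rho : A -> B) (b : R -> A) (op : M -> extend_scalars d2 N).
Hypothesis rhoD : {morph rho : F G / F + G}.
Hypothesis rhoM : forall F h, rho (F * d2 h) = rho F * phi (b h).
Hypothesis opD : {morph op : x y / x + y}.
Hypothesis opZ : forall h x, op (h *: x) = b h *: op x.

Lemma outer_balanced :
  sbalanced d2 (fun F x => slift (inner (rho F)) (op x)).
Proof.
split=> [F F' x|F x x'|F h x].
- by rewrite rhoD slift_innerDl.
- by rewrite opD (sliftD (inner_balanced _)).
- by rewrite rhoM opZ slift_innerZ.
Qed.
End SliftComp.

Section AssocMonoid.
Variables (k : fieldType) (A B C : algType k).

Let assocB : {morph @tensor_assoc k A B C : x y / x - y}.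
Proof. exact: linearB. Qed.

Let assoc0 : @tensor_assoc k A B C 0 = 0.
Proof. exact: linear0. Qed.

Let tensBr (a : A) (s t : tensor B C) : a \ox (s - t) = a \ox s - a \ox t.
Proof. by rewrite -scaleN1r tensDr tensZr scaleN1r. Qed.

Let tens0r (a : A) : a \ox (0 : tensor B C) = 0.
Proof. by rewrite -[X in a \ox X](subrr 0) tensBr subrr. Qed.

Lemma tensor_assoc_monoid : monoid_morphism (@tensor_assoc k A B C).
Proof.
split=> [|s t]; first by rewrite -!tens1 tensor_assoc_tens.
elim/tensor_ind: s => [|x y hx hy|a s]; first by rewrite !(mul0r, assoc0).
  by rewrite mulrBl !assocB mulrBl hx hy.
elim/tensor_ind: s => [|x y hx hy|b c].
  by rewrite tens0r !(mul0r, assoc0).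
  by rewrite tensBr mulrBl !assocB mulrBl hx hy.
elim/tensor_ind: t => [|x y hx hy|a' t]; first by rewrite !(mulr0, assoc0).
  by rewrite mulrBr !assocB mulrBr hx hy.
elim/tensor_ind: t => [|x y hx hy|b' c'].
  by rewrite tens0r !(mulr0, assoc0).
  by rewrite tensBr mulrBr !assocB mulrBr hx hy.
by rewrite !tensM !tensor_assoc_tens !tensM.
Qed.

HB.instance Definition _ := GRing.isMonoidMorphism.Build
  (tensor A (tensor B C)) (tensor (tensor A B) C) (@tensor_assoc k A B C)
  tensor_assoc_monoid.
End AssocMonoid.

Section HopfAlgebra.
Variables (k : fieldType) (H : algType k).
Variables (Delta : {lrmorphism H -> tensor H H}).

Record is_hopf (eps : {lrmorphism H -> k^o}) (S : {linear H -> H}) : Prop := {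
  hopf_coassoc : forall h,
    tensor_map Delta idfun (Delta h) =
      tensor_assoc (tensor_map idfun Delta (Delta h));
  hopf_counitl : forall h, tlift (fun a b => (eps a : k) *: b) (Delta h) = h;
  hopf_counitr : forall h, tlift (fun a b => (eps b : k) *: a) (Delta h) = h;
  hopf_antipodel : forall h,
    tlift (fun a b => S a * b) (Delta h) = (eps h : k)%:A;
  hopf_antipoder : forall h,
    tlift (fun a b => a * S b) (Delta h) = (eps h : k)%:A
}.

Definition cocommutative : Prop := forall h, tensor_swap (Delta h) = Delta h.

End HopfAlgebra.

Section Pseudo.
Variables (k : fieldType) (H : algType k).
Variables (Delta : {lrmorphism H -> tensor H H}).

Local Notation H2 := (tensor H H).
Local Notation H3 := (tensor (tensor H H) H).

(* The third tensor power of H is (H \otimes H) \otimes H throughout; elements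
   naturally written in H \otimes (H \otimes H) are moved by tensor_assoc. *)
Definition Delta_id : H2 -> H3 := tensor_map Delta idfun.
HB.instance Definition _ := GRing.RMorphism.on Delta_id.

Definition id_Delta : H2 -> H3 := @tensor_assoc k H H H \o tensor_map idfun Delta.
HB.instance Definition _ := GRing.RMorphism.on id_Delta.

Definition tens_1r (F : H2) : H3 := F \ox 1.
Definition tens_1l (F : H2) : H3 := tensor_assoc (1 \ox F).

Definition Delta3 : H -> H3 := Delta_id \o Delta.
HB.instance Definition _ := GRing.RMorphism.on Delta3.

Definition pseudo2 (M : lmodType H) : Type := extend_scalars Delta M.
HB.instance Definition _ M := GRing.Lmodule.on (pseudo2 M).

Definition pseudo3 (M : lmodType H) : Type := extend_scalars Delta3 M.
HB.instance Definition _ M := GRing.Lmodule.on (pseudo3 M).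

Definition ptens2 (M : lmodType H) (F : H2) (m : M) : pseudo2 M := stens _ F m.
Definition ptens3 (M : lmodType H) (F : H3) (m : M) : pseudo3 M := stens _ F m.

Section Products.
Variables (L M N : lmodType H).
Implicit Types (op : L -> M -> pseudo2 N).

(* A k-linear map on the tensor product of L and M over k is given as a
   k-bilinear map, the k-structures being those induced by c |-> c%:A.  *)
Record H2_linear op : Prop := {
  op_linl : forall (c : k) x x' y,
    op ((c%:A : H) *: x + x') y = (c%:A : H2) *: op x y + op x' y;
  op_linr : forall (c : k) x y y',
    op x ((c%:A : H) *: y + y') = (c%:A : H2) *: op x y + op x y';
  op_H2 : forall (f g : H) x y, op (f *: x) (g *: y) = (f \ox g) *: op x y
}.

(* (F \otimes_H x) op y and x op (F \otimes_H y), extended additively in the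
   composite argument; see pcomp_lE and pcomp_rE. *)
Definition pcomp_l op (X : pseudo2 L) (y : M) : pseudo3 N :=
  slift (fun F x =>
    slift (fun G e => ptens3 (tens_1r F * Delta_id G) e) (op x y)) X.

Definition pcomp_r op (x : L) (Y : pseudo2 M) : pseudo3 N :=
  slift (fun F y =>
    slift (fun G e => ptens3 (tens_1l F * id_Delta G) e) (op x y)) Y.

Variable op : L -> M -> pseudo2 N.
Hypothesis op_lin : H2_linear op.

Lemma Delta_id_tens f g : Delta_id (f \ox g) = Delta f \ox g.
Proof. exact: tensor_map_tens. Qed.

Lemma id_Delta_tens f g : id_Delta (f \ox g) = tensor_assoc (f \ox Delta g).
Proof. by rewrite /id_Delta /= tensor_map_tens. Qed.

Let opDl y : {morph op^~ y : x x' / x + x'}.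
Proof.
by move=> x x'; have := op_linl op_lin 1 x x' y; rewrite !scale1r.
Qed.

Let opDr x : {morph op x : y y' / y + y'}.
Proof.
by move=> y y'; have := op_linr op_lin 1 x y y'; rewrite !scale1r.
Qed.

Let opZl y h x : op (h *: x) y = (h \ox 1) *: op x y.
Proof. by rewrite -[y in LHS]scale1r op_H2. Qed.

Let opZr x h y : op x (h *: y) = (1 \ox h) *: op x y.
Proof. by rewrite -[x in LHS]scale1r op_H2. Qed.

Lemma pcomp_l_balanced y : sbalanced Delta (fun F x =>
  slift (fun G e => ptens3 (tens_1r F * Delta_id G) e) (op x y)).
Proof.
apply: (@outer_balanced H H2 H3 Delta Delta3 Delta_id L N _
  tens_1r (fun h => h \ox 1) (op^~ y)) => //.
- by move=> F G; rewrite /tens_1r tensDl.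
- move=> F h; transitivity (tens_1r F * (Delta h \ox 1)).
    by rewrite /tens_1r tensM mulr1.
  by congr (_ * _); symmetry; exact: Delta_id_tens.
Qed.

Lemma pcomp_l_tens F x y :
  pcomp_l op (ptens2 F x) y =
    slift (fun G e => ptens3 (tens_1r F * Delta_id G) e) (op x y).
Proof. exact: slift_stens (pcomp_l_balanced y) F x. Qed.

Lemma pcomp_lE (I : Type) (r : seq I) (f g : I -> H) (e : I -> N) F x y :
  op x y = \sum_(i <- r) ptens2 (f i \ox g i) (e i) ->
  pcomp_l op (ptens2 F x) y =
    \sum_(i <- r) ptens3 (tens_1r F * Delta_id (f i \ox g i)) (e i).
Proof.
move=> opE; rewrite pcomp_l_tens opE.
have bal := @inner_balanced H H2 H3 Delta Delta3 Delta_id N (fun=> erefl) (tens_1r F).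
elim: r {opE} => [|i r IH]; first by rewrite !big_nil; exact: (slift0 bal).
by rewrite !big_cons -IH -[X in _ = X + _](slift_stens bal); exact: (sliftD bal).
Qed.

Hypothesis Delta_coassoc : forall h, Delta3 h = id_Delta (Delta h).

Lemma pcomp_r_balanced x : sbalanced Delta (fun F y =>
  slift (fun G e => ptens3 (tens_1l F * id_Delta G) e) (op x y)).
Proof.
apply: (@outer_balanced H H2 H3 Delta Delta3 id_Delta M N _
  tens_1l (fun h => 1 \ox h) (op x)) => //.
- by move=> F G; rewrite /tens_1l tensDr; exact: (raddfD (@tensor_assoc k H H H)).
- move=> F h; transitivity (tens_1l F * tens_1l (Delta h)).
    by rewrite /tens_1l -[RHS](rmorphM (@tensor_assoc k H H H)) tensM mulr1.
  by congr (_ * _); symmetry; exact: id_Delta_tens.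
Qed.

Lemma pcomp_r_tens x F y :
  pcomp_r op x (ptens2 F y) =
    slift (fun G e => ptens3 (tens_1l F * id_Delta G) e) (op x y).
Proof. exact: slift_stens (pcomp_r_balanced x) F y. Qed.

Lemma pcomp_rE (I : Type) (r : seq I) (f g : I -> H) (e : I -> N) x F y :
  op x y = \sum_(i <- r) ptens2 (f i \ox g i) (e i) ->
  pcomp_r op x (ptens2 F y) =
    \sum_(i <- r) ptens3 (tens_1l F * id_Delta (f i \ox g i)) (e i).
Proof.
move=> opE; rewrite pcomp_r_tens opE.
have bal := @inner_balanced H H2 H3 Delta Delta3 id_Delta N
  (fun h => esym (Delta_coassoc h)) (tens_1l F).
elim: r {opE} => [|i r IH]; first by rewrite !big_nil; exact: (slift0 bal).
by rewrite !big_cons -IH -[X in _ = X + _](slift_stens bal); exact: (sliftD bal).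
Qed.

End Products.

Section Omega.
Variables (Omega : semigroupType) (D : lmodType H).

Record Omega_dendriform
    (succ prec : Omega -> Omega -> D -> D -> pseudo2 D) : Prop := {
  dendri_succ_lin : forall a b, H2_linear (succ a b);
  dendri_prec_lin : forall a b, H2_linear (prec a b);
  dendri_prec_prec : forall x y z a b c,
    pcomp_l (prec (a * b)%g c) (prec a b x y) z =
      pcomp_r (prec a (b * c)%g) x (prec b c y z + succ b c y z);
  dendri_succ_prec : forall x y z a b c,
    pcomp_l (prec (a * b)%g c) (succ a b x y) z =
      pcomp_r (succ a (b * c)%g) x (prec b c y z);
  dendri_succ_succ : forall x y z a b c,
    pcomp_l (succ (a * b)%g c) (prec a b x y + succ a b x y) z =
      pcomp_r (succ a (b * c)%g) x (succ b c y z)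
}.

Record Omega_associative
    (mul : Omega -> Omega -> D -> D -> pseudo2 D) : Prop := {
  assoc_lin : forall a b, H2_linear (mul a b);
  assoc_mul : forall x y z a b c,
    pcomp_l (mul (a * b)%g c) (mul a b x y) z =
      pcomp_r (mul a (b * c)%g) x (mul b c y z)
}.
End Omega.
End Pseudo.

(* Main.v *)
(** Composition of pseudoproducts is biadditive: in the composite argument and
    in the outer product.  Expanding both sides of associativity for
    [succ + prec] therefore gives four terms each, and adding the three
    dendriform identities matches them up. *)
Require Import Defs.
From mathcomp Require Import all_boot all_order all_algebra.

Set Implicit Arguments.
Unset Strict Implicit.
Unset Printing Implicit Defensive.

Import GRing.Theory.
Local Open Scope ring_scope.

Section PseudoproductSum.
Variables (k : fieldType) (H : algType k).
Variables (Delta : {lrmorphism H -> tensor H H}).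
Variables (L M N : lmodType H).
Implicit Types op : L -> M -> pseudo2 Delta N.

Lemma H2_linear_add op op' : H2_linear op -> H2_linear op' ->
  H2_linear (fun x y => op x y + op' x y).
Proof.
move=> lin lin'; split=> [c x x' y|c x y y'|f g x y].
- by rewrite !op_linl // scalerDr addrACA.
- by rewrite !op_linr // scalerDr addrACA.
- by rewrite !op_H2 // scalerDr.
Qed.

Lemma pcomp_lD op : H2_linear op ->
  forall y, {morph (pcomp_l op)^~ y : X X' / X + X'}.
Proof. by move=> lin y X X'; exact: sliftD (pcomp_l_balanced lin y) X X'. Qed.

(** Each of the three composites is additive in [X], so it suffices to compare them on pure tensors,
    where composition is an additive lift applied to the value of the outer product. *)
Lemma pcomp_l_add op op' X y : H2_linear op -> H2_linear op' ->
  pcomp_l (fun x y => op x y + op' x y) X y = pcomp_l op X y + pcomp_l op' X y.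
Proof.
move=> lin lin'; have linD := H2_linear_add lin lin'.
have s0 (p : L -> M -> pseudo2 Delta N) : H2_linear p -> pcomp_l p 0 y = 0.
  by move=> plin; exact: slift0 (pcomp_l_balanced plin y).
have sB (p : L -> M -> pseudo2 Delta N) : H2_linear p ->
    {morph (pcomp_l p)^~ y : X X' / X - X'}.
  move=> plin X' X''.
  exact: slift_is_zmod_morphism (pcomp_l_balanced plin y) X' X''.
elim/stens_ind: X => [|X X' hX hX'|F x].
- by rewrite !s0 // addr0.
- by rewrite !sB // hX hX' opprD addrACA.
- rewrite -/(ptens2 _ _) !pcomp_l_tens //.
  (* [erefl] suffices because [Delta3] is by definition [Delta_id] after [Delta]. *)
  exact: sliftD (@inner_balanced H _ _ Delta (Delta3 Delta) (Delta_id Delta) N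
    (fun=> erefl) (tens_1r F)) _ _.
Qed.

Hypothesis Delta_coassoc : forall h, Delta3 Delta h = id_Delta Delta (Delta h).

(** Coassociativity enters here: the target is balanced along [Delta3], while right composition
    produces [id_Delta] after [Delta]. *)
Lemma pcomp_rD op : H2_linear op ->
  forall x, {morph pcomp_r op x : Y Y' / Y + Y'}.
Proof.
by move=> lin x Y Y'; exact: sliftD (pcomp_r_balanced lin Delta_coassoc x) Y Y'.
Qed.

Lemma pcomp_r_add op op' x Y : H2_linear op -> H2_linear op' ->
  pcomp_r (fun x y => op x y + op' x y) x Y = pcomp_r op x Y + pcomp_r op' x Y.
Proof.
move=> lin lin'; have linD := H2_linear_add lin lin'.
have s0 (p : L -> M -> pseudo2 Delta N) : H2_linear p -> pcomp_r p x 0 = 0.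
  by move=> plin; exact: slift0 (pcomp_r_balanced plin Delta_coassoc x).
have sB (p : L -> M -> pseudo2 Delta N) : H2_linear p ->
    {morph pcomp_r p x : Y Y' / Y - Y'}.
  move=> plin Y' Y''.
  exact: slift_is_zmod_morphism (pcomp_r_balanced plin Delta_coassoc x) Y' Y''.
elim/stens_ind: Y => [|Y Y' hY hY'|F y].
- by rewrite !s0 // addr0.
- by rewrite !sB // hY hY' opprD addrACA.
- rewrite -/(ptens2 _ _) !pcomp_r_tens //.
  exact: sliftD (@inner_balanced H _ _ Delta (Delta3 Delta) (id_Delta Delta) N
    (fun h => esym (Delta_coassoc h)) (tens_1l F)) _ _.
Qed.

End PseudoproductSum.

Theorem proposition3p12 (k : closedFieldType) (char0 : [pchar k] =i pred0)
    (H : algType k) (Delta : {lrmorphism H -> tensor H H})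
    (eps : {lrmorphism H -> k^o}) (S : {linear H -> H})
    (hopfH : is_hopf Delta eps S) (cocomH : cocommutative Delta)
    (Omega : semigroupType) (D : lmodType H)
    (succ prec : Omega -> Omega -> D -> D -> pseudo2 Delta D) :
  Omega_dendriform succ prec ->
  Omega_associative (fun a b x y => succ a b x y + prec a b x y).
Proof.
have coassoc h : Delta3 Delta h = id_Delta Delta (Delta h).
  exact: hopf_coassoc hopfH h.
case=> succL precL pp sp ss; split=> [a b|x y z a b c].
  exact: H2_linear_add.
rewrite pcomp_l_add // pcomp_r_add //.
(* With outer product [succ] the whole sum is absorbed by [ss]; with outer product [prec] the sum is
   split, one summand each for [sp] and [pp]. *)
rewrite [X in pcomp_l (succ _ _) X]addrC ss [in LHS]pcomp_lD // sp pp.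
(* The term with outer [prec] now agrees on both sides up to order; only the one with outer [succ]
   needs splitting. *)
rewrite [X in pcomp_r (prec _ _) _ X]addrC [in RHS]pcomp_rD //.
by rewrite addrA.
Qed.
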